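(* Let $\mathcal{P}=(\mathcal{P},d,\mu)$ be a metric measure space. Then $L^\infty(\mathcal{P})$ has the Vitali--Carathéodory property if and only if $\mu(\{x\})>0$ for every $x\in\mathcal{P}$. In particular, if $L^\infty(\mathcal{P})$ has the Vitali--Carathéodory property, then $\mathcal{P}$ is finite or countable.
   Context: Standing assumption: a metric measure space $\mathcal{P}=(\mathcal{P},d,\mu)$ is a metric space equipped with a positive complete Borel measure $\mu$ such that $0<\mu(B)<\infty$ for every ball $B\subset\mathcal{P}$. Vitali--Carathéodory property: $L^\infty(\mathcal{P})$ has the Vitali--Carathéodory property if for every measurable function $u:\mathcal{P}\to[-\infty,\infty]$, $\|u\|_{L^\infty(\mathcal{P})}=\inf\{\|v\|_{L^\infty(\mathcal{P})}: v\ge|u|\text{ on }\mathcal{P}\text{ and }v\text{ is lower semicontinuous on }\mathcal{P}\}$, where inequalities are pointwise everywhere (functions are defined everywhere, not just up to a.e. equivalence). *)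

(* Defs.v *)
From HB Require Import structures.
From mathcomp Require Import all_boot all_order all_algebra.
From mathcomp Require Import all_classical all_reals all_analysis measurable_realfun.

Set Implicit Arguments.
Unset Strict Implicit.
Unset Printing Implicit Defensive.

Import Order.TTheory GRing.Theory Num.Theory.
Import numFieldNormedType.Exports.

Local Open Scope classical_set_scope.
Local Open Scope ring_scope.
Local Open Scope ereal_scope.

(* No relation between the metric and the sigma-algebra is imposed here: see
   [borel_measurable] below.  As for every [measurableType], the carrier is
   nonempty. *)
#[short(type="metricMeasurableType")]
HB.structure Definition MetricMeasurable (R : realType) (d : measure_display) :=
  { T of Metric R T & Measurable d T }.

(* A complete Borel measure lives on a sigma-algebra that contains the Borel
   sets, possibly strictly (e.g. the completion of the Borel sigma-algebra).
   In a [metricType], [ball x r] is the open ball [set y | mdist x y < r]. *)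
Record metric_measure_space (R : realType) (d : measure_display)
    (P : metricMeasurableType R d) (mu : {measure set P -> \bar R}) : Prop := {
  borel_measurable :
    forall A : set P, <<s [set U : set P | open U] >> A -> measurable A ;
  complete_measure : measure_is_complete mu ;
  ball_measure_gt0 : forall (x : P) (r : R), (0 < r)%R -> 0 < mu (ball x r) ;
  ball_measure_lty : forall (x : P) (r : R), (0 < r)%R -> mu (ball x r) < +oo
}.

(* The functions v need no measurability hypothesis: lower semicontinuous
   functions are Borel. *)
Definition Linfty_Vitali_Caratheodory (R : realType) (d : measure_display)
    (P : metricMeasurableType R d) (mu : {measure set P -> \bar R}) : Prop :=
  forall u : P -> \bar R, measurable_fun [set: P] u ->
    'N[mu]_+oo[u] =
    ereal_inf [set 'N[mu]_+oo[v] | v in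
      [set v : P -> \bar R |
        (forall x, `|u x| <= v x) /\ lower_semicontinuous v]].

(* Main.v *)
(* If every point has positive mass, then a property true almost everywhere is
   true everywhere, so the constant function ||u|| is an admissible majorant of
   |u|. Conversely, if {a} is a null set, then the indicator of {a} has norm 0,
   whereas a lower semicontinuous majorant exceeds 1/2 on a whole ball around
   a, which has positive measure. Countability holds because the space is a
   countable union of balls of finite measure, each containing only finitely
   many points of mass at least 1/(n+1). *)

Require Import Defs.
From HB Require Import structures.
From mathcomp Require Import all_boot all_order all_algebra.
From mathcomp Require Import finmap.
From mathcomp Require Import all_classical all_reals all_analysis measurable_realfun.
From mathcomp Require Import ess_sup_inf.

Local Open Scope classical_set_scope.
Local Open Scope ring_scope.
Local Open Scope ereal_scope.

Import Order.TTheory GRing.Theory Num.Theory.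

Section atoms.
Context d (T : measurableType d) (R : realType).
Variables (mu : {measure set T -> \bar R}) (A : set T).
Hypothesis mset1 : forall x : T, measurable [set x].
Hypotheses (mA : measurable A) (muA : mu A < +oo).

(** Distinct points are disjoint sets, so [k] such points force [k * e <= mu A], which bounds
    [k]. *)
Lemma finite_large_atoms (e : R) : (0 < e)%R ->
  finite_set [set x | A x /\ e%:E <= mu [set x]].
Proof.
move=> e0; apply: contrapT.
(* An infinite set has a finite subset [C] with more than [mu A / e] points; its mass would exceed
   that of [A]. *)
move=> /(infinite_set_fset (Num.truncn (fine (mu A) / e)).+1) [C CA nC].
have fA : mu A \is a fin_num by rewrite ge0_fin_numE.
have : mu (\bigcup_(x in [set` C]) [set x]) <= mu A.
  apply: le_measure; rewrite ?inE//.
    exact: fin_bigcup_measurable.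
  by move=> x [y /CA [Ay _] ->].
rewrite bigcup_fset measure_fbigsetU//; last by move=> x y _ _ [z [-> ->]].
apply/negP; rewrite -ltNge.
apply: (@lt_le_trans _ _ (\sum_(x <- C) e%:E)); last first.
  by rewrite !big_seq; apply: lee_sum => x /CA[].
rewrite -(fineK fA) sumEFin lte_fin big_const_seq iter_addr_0 count_predT.
rewrite -mulr_natl -ltr_pdivrMr//.
apply: (lt_le_trans (truncnS_gt _)).
by rewrite ler_nat.
Qed.

Lemma countable_atoms : countable [set x | A x /\ 0 < mu [set x]].
Proof.
apply: (@sub_countable _ _ _
  (\bigcup_n [set x | A x /\ (n.+1%:R^-1)%:E <= mu [set x]])).
  apply: subset_card_le => x [Ax x0].
  (* The Archimedean step below takes place in [R], so the mass of the point must first be seen to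
     be finite. *)
  have fx : mu [set x] \is a fin_num.
    rewrite ge0_fin_numE// (le_lt_trans _ muA)// le_measure ?inE//.
    by move=> _ ->.
  have := x0; rewrite -(fineK fx) lte_fin => /ltr_add_invr[n].
  rewrite add0r => nx; exists n => //; split=> //.
  by rewrite -(fineK fx) lee_fin ltW.
apply: bigcup_countable => // n _; apply: finite_set_countable.
by apply: finite_large_atoms; rewrite invr_gt0.
Qed.

End atoms.

(** A point where [Q] fails would lie in a null set, and by monotonicity its own mass would
    vanish. *)
Lemma ae_everywhere d (T : measurableType d) (R : realType)
    (mu : {measure set T -> \bar R}) (Q : T -> Prop) :
  (forall x : T, measurable [set x]) -> (forall x, 0 < mu [set x]) ->
  (\forall x \ae mu, Q x) -> forall x, Q x.
Proof.
move=> mset1 mu1 [N [mN N0 QN]] x; apply: contrapT => nQx.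
have := mu1 x; rewrite ltNge => /negP; apply; rewrite -N0.
by apply: le_measure; rewrite ?inE// => _ ->; exact: QN.
Qed.

Section metric_measure.
Context (R : realType) (d : measure_display) (P : metricMeasurableType R d).
Variable mu : {measure set P -> \bar R}.
Hypothesis hP : metric_measure_space mu.

Lemma metric_open_measurable (U : set P) : open U -> measurable U.
Proof.
by move=> oU; apply: (borel_measurable hP); exact: sub_sigma_algebra.
Qed.

Lemma metric_set1_measurable (x : P) : measurable [set x].
Proof.
rewrite -[X in measurable X]setCK; apply: measurableC.
apply: metric_open_measurable; apply: closed_openC.
by apply/accessible_closed_set1/hausdorff_accessible; exact: metric_hausdorff.
Qed.

Lemma metric_ball_open (x : P) (r : R) : open (ball x r).
Proof.
rewrite openE => y; rewrite ballEmdist /= => xy.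
apply/nbhs_ballP; exists (r - mdist x y)%R; first by rewrite /= subr_gt0.
move=> z; rewrite !ballEmdist /= ltrBrDl.
by apply: le_lt_trans; exact: metric_triangle.
Qed.

Lemma metric_ball_measurable (x : P) (r : R) : measurable (ball x r).
Proof. exact/metric_open_measurable/metric_ball_open. Qed.

Lemma metric_measureT_gt0 : 0 < mu [set: P].
Proof.
apply: (lt_le_trans (ball_measure_gt0 hP point ltr01)).
apply: le_measure; rewrite ?inE//; exact: metric_ball_measurable.
Qed.

(** The norm at exponent [+oo] is set to 0 when the whole space is null; balls of positive mass
    exclude that case. *)
Lemma LnormyE (u : P -> \bar R) : 'N[mu]_+oo[u] = ess_sup mu (abse \o u).
Proof. by rewrite unlock /= metric_measureT_gt0. Qed.

(** Semicontinuity spreads [r < v] from [a] to a ball. Were the essential supremum below [r], this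
    ball would lie in a null set. *)
Lemma lower_semicontinuous_ess_sup_ge (v : P -> \bar R) (a : P) (r : R) :
  lower_semicontinuous v -> r%:E < v a -> r%:E <= ess_sup mu v.
Proof.
move=> lv /lv[V /nbhs_ballP[e e0 eV] Vv].
rewrite leNgt; apply/negP => vr.
have [N [mN N0 vN]] := ess_sup_ge mu v.
have := ball_measure_gt0 hP a e0; rewrite ltNge => /negP; apply; rewrite -N0.
apply: le_measure; rewrite ?inE//; first exact: metric_ball_measurable.
move=> x /eV/Vv rx; apply: vN => /= vx.
by have := lt_trans rx (le_lt_trans vx vr); rewrite ltxx.
Qed.

Lemma Linfty_Vitali_Caratheodory_set1_gt0 :
  Linfty_Vitali_Caratheodory mu -> forall x : P, 0 < mu [set x].
Proof.
move=> VC a; rewrite lt0e measure_ge0 andbT; apply/eqP => mua0.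
pose u : P -> \bar R := EFin \o \1_[set a].
have mu_ : measurable_fun [set: P] u.
  apply/measurable_EFinP; apply: measurable_indic.
  exact: metric_set1_measurable.
have u0 : 'N[mu]_+oo[u] = 0.
  rewrite LnormyE; apply: abs_ess_sup_eq0; first exact: metric_measureT_gt0.
  exists [set a]; split=> //; first exact: metric_set1_measurable.
  move=> x /= ux; apply: contrapT => xa; apply: ux => _.
  by rewrite /u /= indicE memNset.
(* Any constant strictly between 0 and 1 would do: below [u a = 1], so that semicontinuity at [a]
   applies, and positive, so as to contradict [u0]. *)
have : (2^-1)%:E <= 'N[mu]_+oo[u].
  rewrite (VC u mu_); apply: le_ereal_inf_tmp => _ [v [uv lv] <-].
  rewrite LnormyE.
  have -> : abse \o v = v.
    by apply/funext => x /=; rewrite gee0_abs// (le_trans _ (uv x)).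
  apply: (lower_semicontinuous_ess_sup_ge v a) => //.
  apply: lt_le_trans (uv a); rewrite /u /= indicE mem_set//= normr1 lte_fin.
  by rewrite invf_lt1 ?ltr1n.
by rewrite u0 lee_fin leNgt invr_gt0 ltr0n.
Qed.

Lemma set1_gt0_Linfty_Vitali_Caratheodory :
  (forall x : P, 0 < mu [set x]) -> Linfty_Vitali_Caratheodory mu.
Proof.
move=> mu1 u _; apply/eqP; rewrite eq_le; apply/andP; split.
  apply: le_ereal_inf_tmp => _ [v [uv _] <-]; rewrite !LnormyE.
  apply: le_ess_sup; apply: nearW => x /=.
  by rewrite (le_trans (uv x))// lee_abs.
(* The infimum is attained at this constant, possibly [+oo], whose norm is its own value since it is
   nonnegative and the space is not null. *)
apply: ereal_inf_lbound; exists (cst 'N[mu]_+oo[u]).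
  split=> [|x b bu]; last by exists setT => //; exact: filterT.
  rewrite LnormyE; apply: ae_everywhere => //.
    exact: metric_set1_measurable.
  exact: ess_sup_ge.
rewrite [LHS]LnormyE; apply: ess_sup_ae_cst; first exact: metric_measureT_gt0.
by apply: nearW => x /=; rewrite gee0_abs //; exact: Lnorm_ge0.
Qed.

Lemma countable_set1_gt0 : countable [set x : P | 0 < mu [set x]].
Proof.
apply: (@sub_countable _ _ _
  (\bigcup_n [set x | ball (point : P) n.+1%:R x /\ 0 < mu [set x]])).
  apply: subset_card_le => x x0.
  (* The ball of index [n] has radius [n + 1], which here strictly exceeds the distance. *)
  exists (Num.truncn (mdist point x)) => //; split=> //.
  by rewrite ballEmdist /=; exact: truncnS_gt.
apply: bigcup_countable => // n _; apply: countable_atoms.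
- exact: metric_set1_measurable.
- exact: metric_ball_measurable.
- by apply: (ball_measure_lty hP); rewrite ltr0n.
Qed.

End metric_measure.

Theorem proposition1p3 (R : realType) (d : measure_display)
    (P : metricMeasurableType R d) (mu : {measure set P -> \bar R})
    (hP : metric_measure_space mu) :
  (Linfty_Vitali_Caratheodory mu <-> (forall x : P, 0 < mu [set x])) /\
  (Linfty_Vitali_Caratheodory mu -> countable [set: P]).
Proof.
split; first split.
- exact: Linfty_Vitali_Caratheodory_set1_gt0.
- exact: set1_gt0_Linfty_Vitali_Caratheodory.
- move=> VC; rewrite (_ : setT = [set x : P | 0 < mu [set x]]).
    exact: countable_set1_gt0.
  apply/seteqP; split=> x // _.
  exact: Linfty_Vitali_Caratheodory_set1_gt0 VC x.
Qed.
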